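(* There are infinitely many isomorphism classes of complex $2$-dimensional compatible Novikov algebras. They are described explicitly by the following list, in terms of $3$ three-parameter families, $7$ two-parameter families, $11$ one-parameter families and $7$ additional isomorphism classes (members of a common family being merged). Every nonzero $2$-dimensional compatible Novikov algebra over $\mathbb{C}$ (with multiplications $\cdot$ and $\ast$) is isomorphic to one and only one of the following algebras with basis $e_1,e_2$, with the exceptions to uniqueness stated after the list (parameters $\alpha,\beta,\gamma$ range over $\mathbb{C}$, subject to the indicated restrictions; products of basis elements not listed are zero). Compatible commutative associative algebras: $\mathcal{C}_{03}$: $e_1\ast e_1=e_2$. $\mathcal{C}_{05}^{0}$: $e_1\ast e_1=e_1$. $\mathcal{C}_{06}^{1}$: $e_1\ast e_1=e_1,\ e_1\ast e_2=e_2,\ e_2\ast e_1=e_2$. $\mathcal{C}_{07}$: $e_1\ast e_1=e_1,\ e_2\ast e_2=e_2$. $\mathcal{C}_{13}^{1}$: $e_1\cdot e_1=e_2$; $e_1\ast e_1=e_1,\ e_1\ast e_2=e_2,\ e_2\ast e_1=e_2$. $\mathcal{C}_{15}^{\alpha}$: $e_1\cdot e_1=e_2$; $e_1\ast e_1=\alpha e_2$. $\mathcal{C}_{16}^{0}$: $e_1\cdot e_1=e_2$; $e_1\ast e_1=e_1$. $\mathcal{C}_{18}^{\alpha}$: $e_1\cdot e_1=e_2$; $e_1\ast e_1=\alpha e_2,\ e_1\ast e_2=e_1,\ e_2\ast e_1=e_1,\ e_2\ast e_2=e_2$. $\mathcal{C}_{24}^{0,\beta,0}$: $e_1\cdot e_1=e_1$;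 $e_1\ast e_1=\beta e_1+e_2$. $\mathcal{C}_{25}^{0,\beta,0}$: $e_1\cdot e_1=e_1$; $e_1\ast e_1=\beta e_1$. $\mathcal{C}_{29}^{\alpha}$: $e_1\cdot e_1=e_1$; $e_1\ast e_1=\alpha e_1,\ e_2\ast e_2=e_2$. $\mathcal{C}_{30}^{\alpha,\beta}$: $e_1\cdot e_1=e_1$; $e_1\ast e_1=\alpha e_1+\beta e_2,\ e_1\ast e_2=e_1,\ e_2\ast e_1=e_1,\ e_2\ast e_2=e_2$. $\mathcal{C}_{31}^{1,\beta,\beta}$: $e_1\cdot e_1=e_1,\ e_1\cdot e_2=e_2,\ e_2\cdot e_1=e_2$; $e_1\ast e_1=\beta e_1+e_2,\ e_1\ast e_2=\beta e_2,\ e_2\ast e_1=\beta e_2$. $\mathcal{C}_{32}^{1,\beta,\beta}$: $e_1\cdot e_1=e_1,\ e_1\cdot e_2=e_2,\ e_2\cdot e_1=e_2$; $e_1\ast e_1=\beta e_1,\ e_1\ast e_2=\beta e_2,\ e_2\ast e_1=\beta e_2$. $\mathcal{C}_{34}^{\alpha,\beta}$: $e_1\cdot e_1=e_1,\ e_1\cdot e_2=e_2,\ e_2\cdot e_1=e_2$; $e_1\ast e_1=\alpha e_1,\ e_1\ast e_2=\alpha e_2,\ e_2\ast e_1=\alpha e_2,\ e_2\ast e_2=e_1+\beta e_2$. $\mathcal{C}_{35}^{\alpha}$: $e_1\cdot e_1=e_1,\ e_1\cdot e_2=e_2,\ e_2\cdot e_1=e_2$; $e_1\ast e_1=\alpha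 e_1,\ e_1\ast e_2=\alpha e_2,\ e_2\ast e_1=\alpha e_2,\ e_2\ast e_2=e_2$. $\mathcal{C}_{38}^{\alpha,\beta,\gamma}$: $e_1\cdot e_1=e_1,\ e_2\cdot e_2=e_2$; $e_1\ast e_1=(\gamma+\beta-\alpha)e_1-\beta e_2,\ e_1\ast e_2=\alpha e_1+\beta e_2,\ e_2\ast e_1=\alpha e_1+\beta e_2,\ e_2\ast e_2=-\alpha e_1+\gamma e_2$. $\mathcal{C}_{39}^{\alpha,\beta\neq\alpha}$: $e_1\cdot e_1=e_1,\ e_2\cdot e_2=e_2$; $e_1\ast e_1=\alpha e_1,\ e_2\ast e_2=\beta e_2$. Further algebras: $\mathcal{C}_{01}$: $e_1\ast e_1=e_1+e_2,\ e_2\ast e_1=e_2$. $\mathcal{C}_{04}$: $e_2\ast e_1=e_1$. $\mathcal{C}_{06}^{\alpha\neq1}$: $e_1\ast e_1=e_1,\ e_1\ast e_2=\alpha e_2,\ e_2\ast e_1=e_2$. $\mathcal{C}_{09}^{\alpha,\beta\neq0}$: $e_1\cdot e_1=e_1+e_2,\ e_2\cdot e_1=e_2$; $e_1\ast e_1=\alpha e_1,\ e_1\ast e_2=\beta e_2,\ e_2\ast e_1=\alpha e_2$. $\mathcal{C}_{10}^{\alpha,\beta}$: $e_1\cdot e_1=e_1+e_2,\ e_2\cdot e_1=e_2$; $e_1\ast e_1=\alpha e_1+\beta e_2,\ e_2\ast e_1=\alpha e_2$. $\mathcal{C}_{13}^{\alpha\neq1}$: $e_1\cdot e_1=e_2$;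 $e_1\ast e_1=\alpha e_1,\ e_1\ast e_2=e_2,\ e_2\ast e_1=\alpha e_2$. $\mathcal{C}_{14}^{\alpha}$: $e_1\cdot e_1=e_2$; $e_1\ast e_1=e_1+\alpha e_2,\ e_2\ast e_1=e_2$. $\mathcal{C}_{20}^{\alpha,0}$: $e_2\cdot e_1=e_1$; $e_2\ast e_1=\alpha e_1,\ e_2\ast e_2=e_1$. $\mathcal{C}_{21}^{\alpha,0}$: $e_2\cdot e_1=e_1$; $e_2\ast e_1=\alpha e_1$. $\mathcal{C}_{22}^{\alpha\neq0,\beta}$: $e_2\cdot e_1=e_1$; $e_1\ast e_2=\alpha e_1,\ e_2\ast e_1=\beta e_1,\ e_2\ast e_2=e_1+\alpha e_2$. $\mathcal{C}_{23}^{\alpha\neq0,\beta}$: $e_2\cdot e_1=e_1$; $e_1\ast e_2=\alpha e_1,\ e_2\ast e_1=\beta e_1,\ e_2\ast e_2=\alpha e_2$. $\mathcal{C}_{31}^{\alpha,\beta,\gamma}$ with $(\alpha,\beta,\gamma)\neq(1,\beta,\beta)$: $e_1\cdot e_1=e_1,\ e_1\cdot e_2=\alpha e_2,\ e_2\cdot e_1=e_2$; $e_1\ast e_1=\beta e_1+e_2,\ e_1\ast e_2=\gamma e_2,\ e_2\ast e_1=\beta e_2$. $\mathcal{C}_{32}^{\alpha,\beta,\gamma}$ with $(\alpha,\beta,\gamma)\neq(1,\beta,\beta)$: $e_1\cdot e_1=e_1,\ e_1\cdot e_2=\alpha e_2,\ e_2\cdot e_1=e_2$; $e_1\ast e_1=\beta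 e_1,\ e_1\ast e_2=\gamma e_2,\ e_2\ast e_1=\beta e_2$. $\mathcal{C}_{33}$: $e_1\cdot e_1=e_1,\ e_2\cdot e_1=e_2$; $e_1\ast e_2=e_1,\ e_2\ast e_2=e_2$. All these algebras are non-isomorphic, except $\mathcal{C}_{31}^{0,\beta,\gamma}\cong\mathcal{C}_{32}^{0,\beta,\gamma}$, $\mathcal{C}_{38}^{\alpha,\beta,\gamma}\cong\mathcal{C}_{38}^{\beta,\alpha,-\alpha+\beta+\gamma}$ and $\mathcal{C}_{39}^{\alpha,\beta}\cong\mathcal{C}_{39}^{\beta,\alpha}$.
   Context: All algebras are over $\mathbb{C}$ and all maps are $\mathbb{C}$-linear. A Novikov algebra is a vector space with a bilinear multiplication $\cdot$ satisfying $(x\cdot y)\cdot z-x\cdot(y\cdot z)=(y\cdot x)\cdot z-y\cdot(x\cdot z)$ and $(x\cdot y)\cdot z=(x\cdot z)\cdot y$. A compatible Novikov algebra is a vector space $\mathbf{A}$ with two bilinear multiplications $\cdot$ and $\ast$ such that $(\mathbf{A},\cdot)$, $(\mathbf{A},\ast)$ and $(\mathbf{A},\cdot+\ast)$ are Novikov algebras. A compatible commutative associative algebra is defined in the same way with ''commutative associative'' in place of ''Novikov''. A compatible algebra is nonzero if at least one of the two multiplications is nonzero. An isomorphism of compatible algebras is a linear bijection preserving both multiplications. In multiplication tables, products of basis elements whose value is zero are omitted. In the counts, members such as $\mathcal{C}_{06}^{1}$, $\mathcal{C}_{13}^{1}$, $\mathcal{C}_{31}^{1,\beta,\beta}$, $\mathcal{C}_{32}^{1,\beta,\beta}$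 are counted as part of the families $\mathcal{C}_{06}^{\alpha}$, $\mathcal{C}_{13}^{\alpha}$, $\mathcal{C}_{31}^{\alpha,\beta,\gamma}$, $\mathcal{C}_{32}^{\alpha,\beta,\gamma}$.
   Formalization: The exception C31^{0,β,γ} ≅ C32^{0,β,γ} is stated only for γ≠0 (it fails at γ=0), and the missing exception C34^{α,β} ≅ C34^{α,−β} (via e2 ↦ −e2) is added to the list. *)

(* Defs.v *)
From HB Require Import structures.
From mathcomp Require Import all_boot all_order all_algebra.
From mathcomp Require Import ring.
From mathcomp Require Export reals complex.

Set Implicit Arguments.
Unset Strict Implicit.
Unset Printing Implicit Defensive.

Import GRing.Theory.
Local Open Scope ring_scope.

Definition novikov (V : zmodType) (mul : V -> V -> V) : Prop :=
  (forall x y z, mul (mul x y) z - mul x (mul y z)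
                 = mul (mul y x) z - mul y (mul x z))
  /\ (forall x y z, mul (mul x y) z = mul (mul x z) y).

Definition comm_assoc (V : zmodType) (mul : V -> V -> V) : Prop :=
  commutative mul /\ associative mul.

Record double_algebra (F : fieldType) := DoubleAlgebra {
  carrier :> vectType F;
  dot : {bilinear carrier -> carrier -> carrier};
  ast : {bilinear carrier -> carrier -> carrier}
}.

Section Compatible.
Variable F : fieldType.
Implicit Types A B : double_algebra F.

Definition compatible (P : forall V : zmodType, (V -> V -> V) -> Prop) A : Prop :=
  [/\ P A (dot A), P A (ast A) & P A (fun x y => dot A x y + ast A x y)].

Definition compatible_novikov A : Prop := compatible novikov A.

Definition compatible_comm_assoc A : Prop := compatible comm_assoc A.

Definition nonzero A : Prop :=
  (exists x y, dot A x y <> 0) \/ (exists x y, ast A x y <> 0).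

Definition isomorphic A B : Prop :=
  exists f : {linear A -> B},
    [/\ bijective f,
        {morph f : x y / dot A x y >-> dot B x y}
      & {morph f : x y / ast A x y >-> ast B x y}].

End Compatible.

Section MultiplicationTable.
Variable F : fieldType.

(* The products e1 e1, e1 e2, e2 e1, e2 e2, in this order. *)
Definition table : Type :=
  ('rV[F]_2 * 'rV[F]_2 * 'rV[F]_2 * 'rV[F]_2)%type.

Definition table_mul (t : table) (x y : 'rV[F]_2) : 'rV[F]_2 :=
  let: (t11, t12, t21, t22) := t in
  (x 0 0 * y 0 0) *: t11 + (x 0 0 * y 0 1) *: t12
  + (x 0 1 * y 0 0) *: t21 + (x 0 1 * y 0 1) *: t22.

Fact table_mul_bilinear (t : table) :
  bilinear_for *:%R *:%R (table_mul t).
Proof.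
case: t => [[[t11 t12] t21] t22].
by split=> [u' | u] a x y; apply/rowP=> k; rewrite !mxE; ring.
Qed.

HB.instance Definition _ (t : table) :=
  bilinear_isBilinear.Build F 'rV[F]_2 'rV[F]_2 'rV[F]_2 _ _ (table_mul t)
    (table_mul_bilinear t).

Definition algebra_of_tables (t : table * table) : double_algebra F :=
  @DoubleAlgebra F 'rV[F]_2 (table_mul t.1) (table_mul t.2).

End MultiplicationTable.

Inductive family :=
  | C01 | C03 | C04 | C05 | C06 | C07 | C09 | C10 | C13 | C14 | C15 | C16
  | C18 | C20 | C21 | C22 | C23 | C24 | C25 | C29 | C30 | C31 | C32 | C33
  | C34 | C35 | C38 | C39.

Scheme Boolean Equality for family.

Definition families : seq family :=
  [:: C01; C03; C04; C05; C06; C07; C09; C10; C13; C14; C15; C16;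
      C18; C20; C21; C22; C23; C24; C25; C29; C30; C31; C32; C33;
      C34; C35; C38; C39].

Fact family_codeK :
  cancel (fun f => find (family_beq f) families) (nth C01 families).
Proof. by case. Qed.

HB.instance Definition _ := Countable.copy family (can_type family_codeK).

Fact families_enum : Finite.axiom families.
Proof. by case. Qed.

HB.instance Definition _ := isFinite.Build family families_enum.

Definition arity (f : family) : nat :=
  match f with
  | C01 | C03 | C04 | C05 | C07 | C16 | C33 => 0
  | C06 | C13 | C14 | C15 | C18 | C20 | C21 | C24 | C25 | C29 | C35 => 1
  | C09 | C10 | C22 | C23 | C30 | C34 | C39 => 2
  | C31 | C32 | C38 => 3
  end.

Section Classification.
Variable F : fieldType.

Definition params (n : nat) : Type :=
  match n with
  | 0 => unit
  | 1 => F
  | 2 => (F * F)%type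
  | _ => (F * F * F)%type
  end.

Record label := Label { label_family : family;
                        label_params : params (arity label_family) }.

Local Notation e1 := (delta_mx 0 0 : 'rV[F]_2).
Local Notation e2 := (delta_mx 0 1 : 'rV[F]_2).

(* The table of the multiplication [dot], then that of [ast].  A family with
   constant superscripts keeps only its free parameter: [C24] with parameter b
   is C_24^{0,b,0}, [C25] is C_25^{0,b,0}, [C20] with parameter a is
   C_20^{a,0}, [C21] is C_21^{a,0}; [C05] and [C16] are C_05^0 and C_16^0. *)
Definition tables (f : family) : params (arity f) -> table F * table F :=
  match f return params (arity f) -> table F * table F with
  | C01 => fun _ => ((0, 0, 0, 0), (e1 + e2, 0, e2, 0))
  | C03 => fun _ => ((0, 0, 0, 0), (e2, 0, 0, 0))
  | C04 => fun _ => ((0, 0, 0, 0), (0, 0, e1, 0))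
  | C05 => fun _ => ((0, 0, 0, 0), (e1, 0, 0, 0))
  | C06 => fun a => ((0, 0, 0, 0), (e1, a *: e2, e2, 0))
  | C07 => fun _ => ((0, 0, 0, 0), (e1, 0, 0, e2))
  | C09 => fun '(a, b) => ((e1 + e2, 0, e2, 0), (a *: e1, b *: e2, a *: e2, 0))
  | C10 => fun '(a, b) => ((e1 + e2, 0, e2, 0), (a *: e1 + b *: e2, 0, a *: e2, 0))
  | C13 => fun a => ((e2, 0, 0, 0), (a *: e1, e2, a *: e2, 0))
  | C14 => fun a => ((e2, 0, 0, 0), (e1 + a *: e2, 0, e2, 0))
  | C15 => fun a => ((e2, 0, 0, 0), (a *: e2, 0, 0, 0))
  | C16 => fun _ => ((e2, 0, 0, 0), (e1, 0, 0, 0))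
  | C18 => fun a => ((e2, 0, 0, 0), (a *: e2, e1, e1, e2))
  | C20 => fun a => ((0, 0, e1, 0), (0, 0, a *: e1, e1))
  | C21 => fun a => ((0, 0, e1, 0), (0, 0, a *: e1, 0))
  | C22 => fun '(a, b) => ((0, 0, e1, 0), (0, a *: e1, b *: e1, e1 + a *: e2))
  | C23 => fun '(a, b) => ((0, 0, e1, 0), (0, a *: e1, b *: e1, a *: e2))
  | C24 => fun b => ((e1, 0, 0, 0), (b *: e1 + e2, 0, 0, 0))
  | C25 => fun b => ((e1, 0, 0, 0), (b *: e1, 0, 0, 0))
  | C29 => fun a => ((e1, 0, 0, 0), (a *: e1, 0, 0, e2))
  | C30 => fun '(a, b) => ((e1, 0, 0, 0), (a *: e1 + b *: e2, e1, e1, e2))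
  | C31 => fun '(a, b, c) =>
      ((e1, a *: e2, e2, 0), (b *: e1 + e2, c *: e2, b *: e2, 0))
  | C32 => fun '(a, b, c) =>
      ((e1, a *: e2, e2, 0), (b *: e1, c *: e2, b *: e2, 0))
  | C33 => fun _ => ((e1, 0, e2, 0), (0, e1, 0, e2))
  | C34 => fun '(a, b) =>
      ((e1, e2, e2, 0), (a *: e1, a *: e2, a *: e2, e1 + b *: e2))
  | C35 => fun a => ((e1, e2, e2, 0), (a *: e1, a *: e2, a *: e2, e2))
  | C38 => fun '(a, b, c) =>
      ((e1, 0, 0, e2),
       ((c + b - a) *: e1 - b *: e2, a *: e1 + b *: e2,
        a *: e1 + b *: e2, - a *: e1 + c *: e2))
  | C39 => fun '(a, b) => ((e1, 0, 0, e2), (a *: e1, 0, 0, b *: e2))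
  end.

Definition algebra_of (l : label) : double_algebra F :=
  algebra_of_tables (tables (label_params l)).

Definition admissible (l : label) : bool :=
  match label_family l as f return params (arity f) -> bool with
  | C09 => fun '(a, b) => b != 0
  | C22 | C23 => fun '(a, b) => a != 0
  | C39 => fun '(a, b) => b != a
  | _ => fun _ => true
  end (label_params l).

(* The members of the list of compatible commutative associative algebras;
   the other admissible labels are those of the "further algebras". *)
Definition in_comm_assoc_list (l : label) : bool :=
  match label_family l as f return params (arity f) -> bool with
  | C03 | C05 | C07 | C15 | C16 | C18 | C24 | C25 | C29 | C30
  | C34 | C35 | C38 | C39 => fun _ => true
  | C06 | C13 => fun a => a == 1
  | C31 | C32 => fun '(a, b, c) => (a == 1) && (c == b)
  | _ => fun _ => false
  end (label_params l).

(* Two points differ from the published list of coincidences, which fails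
   without them.  The condition [c != 0] of [coincide_31_32] is needed: in
   C_32^{0,b,0} the multiplication [ast] is b times [dot], whereas in
   C_31^{0,b,0} it is not a multiple of [dot].  The published list omits
   [coincide_34], which is the change of basis e2 |-> - e2. *)
Inductive coincide : label -> label -> Prop :=
  | coincide_31_32 (b c : F) : c != 0 ->
      coincide (@Label C31 (0, b, c)) (@Label C32 (0, b, c))
  | coincide_34 (a b : F) :
      coincide (@Label C34 (a, b)) (@Label C34 (a, - b))
  | coincide_38 (a b c : F) :
      coincide (@Label C38 (a, b, c)) (@Label C38 (b, a, - a + b + c))
  | coincide_39 (a b : F) :
      coincide (@Label C39 (a, b)) (@Label C39 (b, a)).

Definition same_class (l1 l2 : label) : Prop :=
  [\/ l1 = l2, coincide l1 l2 | coincide l2 l1].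

End Classification.

(* Main.v *)
(* Over an algebraically closed field the right multiplications of a Novikov
   algebra commute, hence have a common eigenvector; taking it as second basis
   vector leaves a short case analysis giving seven normal forms.  Once [dot]
   is in normal form, compatibility is a linear system for [ast] together with
   a few quadratic equations, and the remaining freedom is the automorphism
   group of [dot], which is explicit and small: it normalises [ast], and it
   decides which normalised pairs are isomorphic.  All of this is polynomial
   algebra in the structure constants and the four entries of a change of
   basis, most of it settled by Groebner bases ([nsatz]). *)
From HB Require Import structures.
From Stdlib Require Import NsatzTactic.
Require Import Defs.
From mathcomp Require Import all_boot all_order all_algebra.
From mathcomp Require Import ring spectral.

Set Implicit Arguments.
Unset Strict Implicit.
Unset Printing Implicit Defensive.

Import Order.TTheory GRing.Theory Num.Theory VectorInternalTheory.
Local Open Scope ring_scope.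

(** * Polynomial reasoning over a field of characteristic zero *)

Section NsatzInstance.
Variable F : numClosedFieldType.

#[local] Instance field_ring_ops :
  @Ncring.Ring_ops F 0 1 +%R *%R (fun x y => x - y) -%R eq := {}.

#[local] Instance field_ring : Ncring.Ring (Ro := field_ring_ops).
Proof.
split; rewrite /Algebra_syntax.equality /Ncring.eq_notation.
- exact: eq_equivalence.
- by move=> ? ? -> ? ? ->.
- by move=> ? ? -> ? ? ->.
- by move=> ? ? -> ? ? ->.
- by move=> ? ? ->.
- exact: add0r.
- exact: addrC.
- exact: addrA.
- exact: mul1r.
- exact: mulr1.
- exact: mulrA.
- exact: mulrDl.
- by move=> x y z; exact: mulrDr.
- by [].
- exact: subrr.
Qed.

#[local] Instance field_cring : Cring.Cring (Rr := field_ring).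
Proof. exact: mulrC. Qed.

#[local] Instance field_integral_domain :
  Integral_domain.Integral_domain (Rcr := field_cring).
Proof.
split=> [x y /= /eqP|/= /eqP].
  by rewrite mulf_eq0 => /orP[] /eqP; [left|right].
by rewrite oner_eq0.
Qed.

(** Characteristic zero is read off from the order: an integer numeral is built from 1 by sums and
    products. *)
Lemma IPR_gt0 p : 0 < (IPR p : F).
Proof.
by elim: p => [[p|p|] IHp|[p|p|] IHp|] /=;
  rewrite ?addr_gt0 ?mulr_gt0 ?addr_gt0 ?ltr01.
Qed.

Lemma PEc_pos_neq0 p (l : seq F) : ~ interpret3 (PEc (Zpos p)) l = 0.
Proof. by apply/eqP; rewrite gt_eqF ?IPR_gt0. Qed.

Lemma PEc_neg_neq0 p (l : seq F) : ~ interpret3 (PEc (Zneg p)) l = 0.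
Proof. by apply/eqP; rewrite /= oppr_eq0 gt_eqF ?IPR_gt0. Qed.

End NsatzInstance.

#[local] Existing Instance field_ring_ops.
#[local] Existing Instance field_ring.
#[local] Existing Instance field_cring.
#[local] Existing Instance field_integral_domain.

(* The certificate found by [nsatz] may multiply the goal by an integer, which
   is then left to be shown nonzero in the field. *)
Ltac nsatz_field :=
  nsatz; first [exact: PEc_pos_neq0 | exact: PEc_neg_neq0].

(** * Isomorphisms and the transport of identities along them *)

Section General.
Variable K : fieldType.
Implicit Types A B C : double_algebra K.

Lemma isomorphicI A B (f : A -> B) : linear f -> bijective f ->
  {morph f : x y / dot A x y >-> dot B x y} ->
  {morph f : x y / ast A x y >-> ast B x y} -> isomorphic A B.
Proof.
move=> lin_f bij_f dot_f ast_f.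
pose f_lin := GRing.isLinear.Build _ _ _ _ f lin_f.
pose g : {linear A -> B} := HB.pack f f_lin.
by exists g.
Qed.

Lemma isomorphic_refl A : isomorphic A A.
Proof. by apply: (@isomorphicI _ _ id) => //; exists id. Qed.

Lemma isomorphic_sym A B : isomorphic A B -> isomorphic B A.
Proof.
case=> f [[g fK gK] dot_f ast_f]; apply: (@isomorphicI _ _ g).
- exact: can2_linear fK gK.
- by exists f.
- by move=> x y; apply: (can_inj fK); rewrite dot_f !gK.
- by move=> x y; apply: (can_inj fK); rewrite ast_f !gK.
Qed.

Lemma isomorphic_trans A B C :
  isomorphic A B -> isomorphic B C -> isomorphic A C.
Proof.
case=> f [bij_f dot_f ast_f] [g [bij_g dot_g ast_g]].
apply: (@isomorphicI _ _ (g \o f)).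
- by move=> a x y; rewrite /= !linearP.
- exact: bij_comp.
- by move=> x y; rewrite /= dot_f dot_g.
- by move=> x y; rewrite /= ast_f ast_g.
Qed.

Lemma novikov_ext (V : zmodType) (m m' : V -> V -> V) :
  (forall x y, m x y = m' x y) -> novikov m -> novikov m'.
Proof. by move=> e [ls rs]; split=> x y z; rewrite -!e. Qed.

Lemma novikov_morph (V W : zmodType) (f : {additive V -> W})
    (m : V -> V -> V) (m' : W -> W -> W) :
  bijective f -> {morph f : x y / m x y >-> m' x y} -> novikov m -> novikov m'.
Proof.
case=> g fK gK fM [ls rs]; split=> x y z; rewrite -(gK x) -(gK y) -(gK z).
  by rewrite -!fM -!raddfB ls.
by rewrite -!fM rs.
Qed.

(** Right commutativity turns [x (y z) = (y z) x] into [(y x) z]. *)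
Lemma comm_novikov_assoc (V : zmodType) (m : V -> V -> V) :
  commutative m -> novikov m -> comm_assoc m.
Proof. by move=> mC [_ rs]; split=> // x y z; rewrite [LHS]mC rs (mC y). Qed.

Lemma isomorphic_novikov A B :
  isomorphic A B -> compatible_novikov A -> compatible_novikov B.
Proof.
case=> f [bij_f dot_f ast_f] [dot_n ast_n sum_n]; split.
- exact: novikov_morph dot_f dot_n.
- exact: novikov_morph ast_f ast_n.
- apply: novikov_morph bij_f _ sum_n => x y.
  by rewrite -dot_f -ast_f raddfD.
Qed.

Lemma isomorphic_nonzero A B : isomorphic A B -> nonzero A -> nonzero B.
Proof.
case=> f [bij_f dot_f ast_f] [] [x [y xy]]; [left | right];
  exists (f x), (f y); rewrite -?dot_f -?ast_f => /eqP;
  by rewrite -(raddf0 f) (bij_eq bij_f) => /eqP.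
Qed.

End General.

(** * Structure constants, and the list of algebras expressed by them *)

Section Classification.
Variable F : numClosedFieldType.
Local Notation label := (label F).
Local Notation rV := 'rV[F]_2.
Local Notation e1 := (delta_mx 0 0 : rV).
Local Notation e2 := (delta_mx 0 1 : rV).

(* The coordinates of e1 e1, e1 e2, e2 e1 and e2 e2, in this order. *)
Variant consts := Consts of F & F & F & F & F & F & F & F.

Definition consts0 := Consts 0 0 0 0 0 0 0 0.

Definition consts_add (t t' : consts) :=
  let: Consts a b c d f g h k := t in
  let: Consts a' b' c' d' f' g' h' k' := t' in
  Consts (a + a') (b + b') (c + c') (d + d')
         (f + f') (g + g') (h + h') (k + k').

(* The first four equations are left symmetry for the triples (e1, e2, e1) and
   (e1, e2, e2), the last three right commutativity for (e1, e1, e2) and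
   (e2, e1, e2), two of whose four coordinates agree up to sign; these triples
   suffice by antisymmetry. *)
Definition novikov_consts (t : consts) :=
  let: Consts a b c d f g h k := t in
  [/\ [/\ a * c - a * f + b * h - c * g + d * f - f * g = 0,
          a * g + b * c - b * f - b * f + b * k - g * g = 0,
          c * c - a * h - c * k + d * h + d * h - g * h = 0
        & c * d - b * h + c * g - d * f + d * k - g * k = 0],
      b * h - d * f = 0, a * d - b * c + b * k - d * g = 0
    & c * f - a * h - f * k + g * h = 0].

(* e1 |-> p e1 + q e2, e2 |-> r e1 + s e2 is a morphism from t to t'. *)
Definition maps (p q r s : F) (t t' : consts) :=
  let: Consts a b c d f g h k := t in
  let: Consts a' b' c' d' f' g' h' k' := t' in
  [/\ [/\ a * p + b * r = p * p * a' + p * q * c' + q * p * f' + q * q * h'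
        & a * q + b * s = p * p * b' + p * q * d' + q * p * g' + q * q * k'],
      [/\ c * p + d * r = p * r * a' + p * s * c' + q * r * f' + q * s * h'
        & c * q + d * s = p * r * b' + p * s * d' + q * r * g' + q * s * k'],
      [/\ f * p + g * r = r * p * a' + r * q * c' + s * p * f' + s * q * h'
        & f * q + g * s = r * p * b' + r * q * d' + s * p * g' + s * q * k']
    & [/\ h * p + k * r = r * r * a' + r * s * c' + s * r * f' + s * s * h'
        & h * q + k * s = r * r * b' + r * s * d' + s * r * g' + s * s * k']].

(* Invertibility is witnessed by u so that it is a polynomial equation. *)
Definition sim (t t' : consts * consts) :=
  exists p q r s, exists u,
    [/\ (p * s - q * r) * u = 1, maps p q r s t.1 t'.1 & maps p q r s t.2 t'.2].

(* N0 is the zero algebra; the other types are numbered as the families with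
   zero [dot] and [ast] of that type. *)
Variant novikov_type := N0 | N01 | N03 | N04 | N05 | N06 of F | N07.

Definition type_consts (n : novikov_type) : consts :=
  match n with
  | N0 => consts0
  | N01 => Consts 1 1 0 0 0 1 0 0
  | N03 => Consts 0 1 0 0 0 0 0 0
  | N04 => Consts 0 0 0 0 1 0 0 0
  | N05 => Consts 1 0 0 0 0 0 0 0
  | N06 a => Consts 1 0 0 a 0 1 0 0
  | N07 => Consts 1 0 0 0 0 0 0 1
  end.

Definition dot_type (l : label) : novikov_type :=
  match label_family l as f return params F (arity f) -> novikov_type with
  | C01 | C03 | C04 | C05 | C06 | C07 => fun _ => N0
  | C09 | C10 => fun _ => N01
  | C13 | C14 | C15 | C16 | C18 => fun _ => N03
  | C20 | C21 | C22 | C23 => fun _ => N04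
  | C24 | C25 | C29 | C30 => fun _ => N05
  | C31 | C32 => fun '(a, _, _) => N06 a
  | C33 => fun _ => N06 0
  | C34 | C35 => fun _ => N06 1
  | C38 | C39 => fun _ => N07
  end (label_params l).

Definition ast_consts (l : label) : consts :=
  match label_family l as f return params F (arity f) -> consts with
  | C01 => fun _ => type_consts N01
  | C03 => fun _ => type_consts N03
  | C04 => fun _ => type_consts N04
  | C05 => fun _ => type_consts N05
  | C06 => fun a => type_consts (N06 a)
  | C07 => fun _ => type_consts N07
  | C09 => fun '(a, b) => Consts a 0 0 b 0 a 0 0
  | C10 => fun '(a, b) => Consts a b 0 0 0 a 0 0
  | C13 => fun a => Consts a 0 0 1 0 a 0 0
  | C14 => fun a => Consts 1 a 0 0 0 1 0 0
  | C15 => fun a => Consts 0 a 0 0 0 0 0 0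
  | C16 => fun _ => Consts 1 0 0 0 0 0 0 0
  | C18 => fun a => Consts 0 a 1 0 1 0 0 1
  | C20 => fun a => Consts 0 0 0 0 a 0 1 0
  | C21 => fun a => Consts 0 0 0 0 a 0 0 0
  | C22 => fun '(a, b) => Consts 0 0 a 0 b 0 1 a
  | C23 => fun '(a, b) => Consts 0 0 a 0 b 0 0 a
  | C24 => fun b => Consts b 1 0 0 0 0 0 0
  | C25 => fun b => Consts b 0 0 0 0 0 0 0
  | C29 => fun a => Consts a 0 0 0 0 0 0 1
  | C30 => fun '(a, b) => Consts a b 1 0 1 0 0 1
  | C31 => fun '(a, b, c) => Consts b 1 0 c 0 b 0 0
  | C32 => fun '(a, b, c) => Consts b 0 0 c 0 b 0 0
  | C33 => fun _ => Consts 0 0 1 0 0 0 0 1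
  | C34 => fun '(a, b) => Consts a 0 0 a 0 a 1 b
  | C35 => fun a => Consts a 0 0 a 0 a 0 1
  | C38 => fun '(a, b, c) => Consts (c + b - a) (- b) a b a b (- a) c
  | C39 => fun '(a, b) => Consts a 0 0 0 0 0 0 b
  end (label_params l).

Definition label_consts (l : label) : consts * consts :=
  (type_consts (dot_type l), ast_consts l).

(** * Uniqueness: normal forms and labels up to isomorphism *)

Lemma neq0_inv (x : F) : x != 0 -> exists y, x * y = 1.
Proof. by move=> x0; exists x^-1; rewrite divff. Qed.

Lemma one_neq_zero : 1 = 0 :> F -> False.
Proof. by move/eqP; rewrite oner_eq0. Qed.

Definition zero_oneE :=
  (@mulr1n F, @mulr0n F, @mul0r F, @mulr0 F, @mul1r F, @mulr1 F,
   @add0r F, @addr0 F, @oppr0 F, @subr0 F, @sub0r F).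

(** For distinct types the morphism equations and the determinant imply [1 = 0]; for two types [N06]
    they imply that the parameters agree. *)
Lemma type_unique n n' :
  sim (consts0, type_consts n) (consts0, type_consts n') -> n = n'.
Proof.
case=> p [q [r [s [u [det _]]]]].
case: n => [||||| a|]; case: n' => [||||| a'|] //=;
  rewrite ?zero_oneE => -[[? ?] [? ?] [? ?] [? ?]];
  by [exfalso; apply: one_neq_zero; nsatz_field | congr N06; nsatz_field].
Qed.

Ltac contradiction_nsatz :=
  solve [exfalso; apply: one_neq_zero; nsatz_field].

(** * Automorphisms of the one-multiplication normal forms *)

Section Aut.
Variables p q r s u : F.
Hypothesis det : (p * s - q * r) * u = 1.

Ltac unfold_maps := rewrite /= ?zero_oneE => -[[? ?] [? ?] [? ?] [? ?]].

Lemma aut_N01 : maps p q r s (type_consts N01) (type_consts N01) ->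
  [/\ p = 1, r = 0 & s = 1].
Proof. by unfold_maps; split; nsatz_field. Qed.

Lemma aut_N03 : maps p q r s (type_consts N03) (type_consts N03) ->
  r = 0 /\ s = p * p.
Proof. by unfold_maps; split; nsatz_field. Qed.

Lemma aut_N04 : maps p q r s (type_consts N04) (type_consts N04) ->
  [/\ q = 0, r = 0 & s = 1].
Proof. by unfold_maps; split; nsatz_field. Qed.

Lemma aut_N05 : maps p q r s (type_consts N05) (type_consts N05) ->
  [/\ p = 1, q = 0 & r = 0].
Proof. by unfold_maps; split; nsatz_field. Qed.

(** The shear coefficient [q] can be nonzero only for [a = 0], which is where [C31] and [C32]
    meet. *)
Lemma aut_N06 a : maps p q r s (type_consts (N06 a)) (type_consts (N06 a)) ->
  [/\ p = 1, r = 0 & q * a = 0].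
Proof. by unfold_maps; split; nsatz_field. Qed.

(** An automorphism permutes the two primitive idempotents [e1] and [e2]; the first coordinate [p]
    of the image of [e1] is itself idempotent. *)
Lemma aut_N07 : maps p q r s (type_consts N07) (type_consts N07) ->
  [/\ p = 1, q = 0, r = 0 & s = 1] \/ [/\ p = 0, q = 1, r = 1 & s = 0].
Proof.
unfold_maps; have /eqP : p * (p - 1) = 0 by nsatz_field.
rewrite mulf_eq0 => /orP[] /eqP ?; [right | left]; split; nsatz_field.
Qed.
End Aut.

(* The value at N0 is junk: no label has both multiplications zero. *)
Definition type_label (n : novikov_type) : label :=
  match n with
  | N0 => @Label F C03 tt
  | N01 => @Label F C01 tt
  | N03 => @Label F C03 tt
  | N04 => @Label F C04 tt
  | N05 => @Label F C05 tt
  | N06 a => @Label F C06 a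
  | N07 => @Label F C07 tt
  end.

Lemma dot_zero_label (l : label) : dot_type l = N0 ->
  exists n, [/\ n <> N0, l = type_label n & ast_consts l = type_consts n].
Proof.
case: l => [[] x] //=; do ?[case: x => x ?] => // _.
- by case: x; exists N01.
- by case: x; exists N03.
- by case: x; exists N04.
- by case: x; exists N05.
- by exists (N06 x).
- by case: x; exists N07.
Qed.

(** Splits a label into its family and scalar parameters; the hypothesis on [dot_type] discards the
    families of another type. *)
Ltac case_label l :=
  let x := fresh "x" in let adm := fresh "adm" in let E := fresh "E" in
  case: l => [[] x];
  repeat lazymatch type of x with
  | ?T => lazymatch eval hnf in T with
          | prod _ _ => let y := fresh "y" in case: x => x y
          | unit => case: x
          | _ => progress (simpl in x)
          end
  end;
  move=> adm E; first [discriminate E | rewrite /dot_type /= in E].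

Lemma label_unique (l l' : label) : admissible l -> admissible l' ->
  sim (label_consts l) (label_consts l') ->
  same_class l l'.
Proof.
move=> adm adm' [p [q [r [s [u [det dot_map ast_map]]]]]].
(* Forgetting [ast] leaves an isomorphism between the [dot] algebras. *)
have dot_eq : dot_type l = dot_type l'.
  by apply: type_unique; exists p, q, r, s, u; split=> //=; rewrite !zero_oneE.
move En: (dot_type l) => n; have En' := En; rewrite dot_eq in En'.
rewrite /label_consts /= En En' in dot_map.
case: n En En' dot_map => [/dot_zero_label[n [_ En An]]
  /dot_zero_label[n' [_ En' An']] _|||||a|].
  rewrite /label_consts /= An An' in ast_map.
  apply: Or31; rewrite En En'; congr type_label; apply: type_unique.
  by exists p, q, r, s, u; split=> //=; rewrite !zero_oneE.
all: move=> En En' dot_map.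
all: move: ast_map; rewrite /label_consts /=.
(* Both [dot] tables are now the same, so the change of basis is an automorphism of that normal
   form. *)
all: first [case: (aut_N01 det dot_map) => ? ? ?; subst
  | case: (aut_N03 det dot_map) => ? ?; subst
  | case: (aut_N04 det dot_map) => ? ? ?; subst
  | case: (aut_N05 det dot_map) => ? ? ?; subst
  | case: (aut_N06 det dot_map) => ? ? ?; subst
  | case: (aut_N07 det dot_map) => -[? ? ? ?]; subst ].
all: clear dot_map dot_eq; move: l' adm' En'; move: l adm En.
all: let l := fresh "l" in move=> l; case_label l.
all: let l := fresh "l" in move=> l; case_label l.
all: rewrite /ast_consts /= ?zero_oneE; case=> -[? ?] [? ?] [? ?] [? ?].
all: repeat match goal with
  | H : ?x = ?x |- _ => clear H
  | H : ?x = ?y |- _ => is_var x; subst x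
  | H : ?x = ?y |- _ => is_var y; subst y
  | H : N06 _ = N06 _ |- _ => case: H => H
  end.
(* Each admissibility condition becomes the existence of an inverse, hence a polynomial equation. *)
all: repeat match goal with H : is_true (admissible _) |- _ =>
    rewrite /admissible /= in H;
    first [ move/neq0_inv: H; case=> ? ?
          | move: H; rewrite -subr_eq0; move/neq0_inv; case=> ? ?
          | clear H]
  end.
all: try solve [apply: Or31; reflexivity].
(* Within one family the equations determine the parameters, except in [C34], where one is
   determined only up to sign. *)
all: lazymatch goal with
  | |- same_class {| label_family := C34 |} {| label_family := C34 |} => idtac
  | |- same_class {| label_family := ?f |} {| label_family := ?f |} =>
    try solve [apply: Or31; apply: (f_equal (@Label F f));
      repeat match goal with |- (_, _) = (_, _) => congr (_, _) end;
      nsatz_field]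
  | _ => idtac
  end.
all: try contradiction_nsatz.
(* The survivors are C31/C32, C32/C31, C34/C34, and C38/C38 and C39/C39 under
   the exchange of e1 and e2. *)
- have [a0 s_eq y_eq] : [/\ a = 0, q * y1 = s & y = y1] by split; nsatz_field.
  subst a y; apply: Or32; apply: coincide_31_32; apply/eqP => y0.
  by apply: one_neq_zero; nsatz_field.
- have [a0 q_eq y_eq] : [/\ a = 0, - q * y1 = 1 & y = y1] by split; nsatz_field.
  subst a y; apply: Or33; apply: coincide_31_32; apply/eqP => y0.
  by apply: one_neq_zero; nsatz_field.
- have q0 : q = 0 by nsatz_field.
  subst q; rewrite !zero_oneE.
  (* The [e1]-coefficient 1 of the [ast]-square of [e2] forces [s * s = 1]. *)
  have /eqP : (y - y0) * (y + y0) = 0 by nsatz_field.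
  rewrite mulf_eq0 subr_eq0 addr_eq0 => /orP[] /eqP ->; first exact: Or31.
  by apply: Or33; apply: coincide_34.
- apply: Or33; rewrite (_ : _ - x0 = - x0 + y2 + y1); last by ring.
  exact: coincide_38.
- exact: (Or32 _ _ (coincide_39 _ _)).
Qed.

(** * Existence: reduction of structure constants to the list *)

Lemma inv_sqrt_exists (x : F) : x != 0 -> exists y, x * (y * y) = 1.
Proof. by move=> x0; exists (sqrtC x^-1); rewrite -expr2 sqrtCK divff. Qed.

Lemma half_exists : exists x : F, x + x = 1.
Proof. by exists 2^-1; rewrite -mulr2n -[LHS]mulr_natl divff ?pnatr_eq0. Qed.

(** Either alternative is a polynomial equation, the form that [nsatz] can use. *)
Lemma inv_cases (x : F) : x = 0 \/ exists y, x * y = 1.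
Proof. by case: (eqVneq x 0) => [->|/neq0_inv]; [left | right]. Qed.

Lemma simI (p q r s u : F) (t1 t2 t1' t2' : consts) :
  (p * s - q * r) * u = 1 -> maps p q r s t1 t1' -> maps p q r s t2 t2' ->
  sim (t1, t2) (t1', t2').
Proof. by exists p, q, r, s, u. Qed.

Ltac sim_eqs := by rewrite /= ?zero_oneE; do ?split; nsatz_field.

(** The two zeros say that [e2] spans a right ideal. If [c] or [m] is nonzero, a multiple of [e2] is
    idempotent and becomes the new first vector; otherwise [a] and the products of [e1] with [e2]
    decide. In each call of [simI], the pairs [(p, q)] and [(r, s)] are the normalised basis in the
    old coordinates. *)
Lemma novikov_type_exists (a b c d l m : F) :
  novikov_consts (Consts a b c d 0 l 0 m) ->
  exists n, sim (consts0, type_consts n) (consts0, Consts a b c d 0 l 0 m).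
Proof.
rewrite /= ?zero_oneE => -[[? ? ? ?] _ ? ?].
case: (inv_cases c) => [c0|[w cw]]; last first.
  exists (N06 0); apply: (@simI 0 w c (- l) (- 1)); sim_eqs.
subst c; case: (inv_cases m) => [m0|[v mv]]; last first.
  case: (inv_cases a) => [a0|[w aw]].
    exists N05; apply: (@simI 0 v m (- l) (- 1)); sim_eqs.
  exists N07; apply: (@simI 0 v w (- l * v * w) (- (m * a))); sim_eqs.
subst m; case: (inv_cases a) => [a0|[w aw]].
  have l0 : l = 0 by nsatz_field.
  subst a l; case: (inv_cases d) => [d0|[z dz]].
    subst d; case: (inv_cases b) => [b0|[z bz]].
      subst b; exists N0; apply: (@simI 1 0 0 1 1); sim_eqs.
    exists N03; apply: (@simI 1 0 0 b z); sim_eqs.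
  exists N04; apply: (@simI 0 1 z (- b * z * z) (- d)); sim_eqs.
case: (eqVneq l a) => [l_eq|].
  subst l; case: (inv_cases d) => [d0|[z dz]].
    subst d; case: (inv_cases b) => [b0|[z bz]].
      subst b; exists (N06 0); apply: (@simI w 0 0 1 a); sim_eqs.
    exists N01; apply: (@simI w 0 0 (b * w * w) (a * a * a * z)); sim_eqs.
  exists (N06 (d * w)); apply: (@simI w (- b * w * z) 0 1 a); sim_eqs.
rewrite -subr_eq0 => /neq0_inv[x lax].
have [l0 d0] : l = 0 /\ d = 0 by split; nsatz_field.
subst l d; exists N05; apply: (@simI w (b * w * w) 0 1 a); sim_eqs.
Qed.

(** Compatibility leaves [a], [b], [d] free. The automorphisms of [dot] are the shears
    [e1 |-> e1 + q e2], and one of them removes [b] as soon as [d] is nonzero. *)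
Lemma label_exists_N01 (t : consts) : novikov_consts t ->
  novikov_consts (consts_add (type_consts N01) t) ->
  exists2 l : label, admissible l & sim (label_consts l) (type_consts N01, t).
Proof.
case: t => a b c d f g h k; rewrite /= ?zero_oneE.
case=> -[? ? ? ?] ? ? ? [[? ? ? ?] ? ? ?].
have [h0 f0 c0 k0 ga] : [/\ h = 0, f = 0, c = 0, k = 0 & g = a].
  by split; nsatz_field.
subst h f c k g; case: (inv_cases d) => [d0|[z dz]].
  subst d; exists (@Label F C10 (a, b)) => //.
  apply: (@simI 1 0 0 1 1); sim_eqs.
exists (@Label F C09 (a, d)).
  by apply/eqP=> d0; apply: one_neq_zero; nsatz_field.
apply: (@simI 1 (- b * z) 0 1 1); sim_eqs.
Qed.

Lemma label_exists_N03 (t : consts) : novikov_consts t ->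
  novikov_consts (consts_add (type_consts N03) t) ->
  exists2 l : label, admissible l & sim (label_consts l) (type_consts N03, t).
Proof.
case: t => a b c d f g h k; rewrite /= ?zero_oneE.
case=> -[? ? ? ?] ? ? ? [[? ? ? ?] ? ? ?].
have [h0 f_eq k_eq] : [/\ h = 0, f = c & k = c] by split; nsatz_field.
(* Scaling [e1] by [w] scales [e2] by [w * w], and hence [c] as well; a square root brings [c] to
   1. *)
subst h f k; case: (eqVneq c 0) => [c0|/inv_sqrt_exists[w cw]].
  subst c; case: (inv_cases d) => [d0|[z dz]].
    subst d; case: (inv_cases a) => [a0|[z az]].
      have g0 : g = 0 by nsatz_field.
      subst a g; exists (@Label F C15 b) => //.
      apply: (@simI 1 0 0 1 1); sim_eqs.
    case: (eqVneq g 0) => [g0|/neq0_inv[y gy]].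
      subst g; exists (@Label F C16 tt) => //.
      apply: (@simI z (z * z * b) 0 (z * z) (a * a * a)); sim_eqs.
    have g_eq : g = a by nsatz_field.
    subst g; exists (@Label F C14 b) => //.
    apply: (@simI z 0 0 (z * z) (a * a * a)); sim_eqs.
  have g_eq : g = a by nsatz_field.
  subst g; exists (@Label F C13 (z * a)) => //.
  apply: (@simI z (- z * z * b) 0 (z * z) (d * d * d)); sim_eqs.
have [d0 g0] : d = 0 /\ g = 0 by split; nsatz_field.
have [y y2] := half_exists.
(* Completing the square: with [w * w] equal to [1 / c] and [y] to one half, adding [v e2] to [w e1]
   removes the [e1]-coefficient of its [ast]-square. *)
pose v := - (w * w * w) * a * y; subst d g.
exists (@Label F C18 (b + v * v * c * c)) => //.
have v_eq : v = - (w * w * w) * a * y by [].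
move: v v_eq => v v_eq; apply: (@simI w v 0 (w * w) (w * c * c)); sim_eqs.
Qed.

(** Only the scale of [e1] is free; it brings [h] to 0 or 1. *)
Lemma label_exists_N04 (t : consts) : novikov_consts t ->
  novikov_consts (consts_add (type_consts N04) t) ->
  exists2 l : label, admissible l & sim (label_consts l) (type_consts N04, t).
Proof.
case: t => a b c d f g h k; rewrite /= ?zero_oneE.
case=> -[? ? ? ?] ? ? ? [[? ? ? ?] ? ? ?].
have [a0 b0 d0 g0 k_eq] : [/\ a = 0, b = 0, d = 0, g = 0 & k = c].
  by split; nsatz_field.
subst a b d g k; case: (eqVneq c 0) => [c0|c0];
  case: (inv_cases h) => [h0|[z hz]].
- subst c h; exists (@Label F C21 f) => //.
  apply: (@simI 1 0 0 1 1); sim_eqs.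
- subst c; exists (@Label F C20 f) => //.
  apply: (@simI h 0 0 1 z); sim_eqs.
- subst h; exists (@Label F C23 (c, f)) => //.
  apply: (@simI 1 0 0 1 1); sim_eqs.
- exists (@Label F C22 (c, f)) => //.
  apply: (@simI h 0 0 1 z); sim_eqs.
Qed.

(** Only the scale of [e2] is free; it brings the first nonzero constant among [c], [k], [b] to
    1. *)
Lemma label_exists_N05 (t : consts) : novikov_consts t ->
  novikov_consts (consts_add (type_consts N05) t) ->
  exists2 l : label, admissible l & sim (label_consts l) (type_consts N05, t).
Proof.
case: t => a b c d f g h k; rewrite /= ?zero_oneE.
case=> -[? ? ? ?] ? ? ? [[? ? ? ?] ? ? ?].
have [d0 g0 h0 f_eq] : [/\ d = 0, g = 0, h = 0 & f = c].
  by split; nsatz_field.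
subst d g h f; case: (inv_cases c) => [c0|[z cz]]; last first.
  have k_eq : k = c by nsatz_field.
  subst k; exists (@Label F C30 (a, b * c)) => //.
  apply: (@simI 1 0 0 z c); sim_eqs.
subst c; case: (inv_cases k) => [k0|[z kz]]; last first.
  have b0 : b = 0 by nsatz_field.
  subst b; exists (@Label F C29 a) => //.
  apply: (@simI 1 0 0 z k); sim_eqs.
subst k; case: (inv_cases b) => [b0|[z bz]].
  subst b; exists (@Label F C25 a) => //.
  apply: (@simI 1 0 0 1 1); sim_eqs.
exists (@Label F C24 a) => //.
apply: (@simI 1 0 0 b z); sim_eqs.
Qed.

Lemma label_exists_N06_diag (x a b d : F) :
  exists2 l : label, admissible l
    & sim (label_consts l) (type_consts (N06 x), Consts a b 0 d 0 a 0 0).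
Proof.
case: (inv_cases b) => [b0|[z bz]].
  subst b; exists (@Label F C32 (x, a, d)) => //.
  apply: (@simI 1 0 0 1 1); sim_eqs.
exists (@Label F C31 (x, a, d)) => //.
apply: (@simI 1 0 0 b z); sim_eqs.
Qed.

(** For [x = 1] the vector [e1] is a unit of [dot], and only then can [h] be nonzero. For other [x],
    a nonzero [c] forces [x = 0]. *)
Lemma label_exists_N06 (x : F) (t : consts) : novikov_consts t ->
  novikov_consts (consts_add (type_consts (N06 x)) t) ->
  exists2 l : label, admissible l
    & sim (label_consts l) (type_consts (N06 x), t).
Proof.
case: t => a b c d f g h k; rewrite /= ?zero_oneE.
case=> -[? ? ? ?] ? ? ? [[? ? ? ?] ? ? ?].
have [f0 g_eq] : f = 0 /\ g = a by split; nsatz_field.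
subst f g; case: (eqVneq x 1) => [x1|].
  subst x; have c0 : c = 0 by nsatz_field.
  subst c; case: (eqVneq h 0) => [h0|h0].
    subst h; case: (inv_cases k) => [k0|[z kz]].
      by subst k; apply: label_exists_N06_diag.
    have [b0 d_eq] : b = 0 /\ d = a by split; nsatz_field.
    subst b d; exists (@Label F C35 a) => //.
    apply: (@simI 1 0 0 z k); sim_eqs.
  (* Scaling [e2] by [z] multiplies [h] by [z * z]. *)
  have [z hz] := inv_sqrt_exists h0.
  have [b0 d_eq] : b = 0 /\ d = a by split; nsatz_field.
  subst b d; exists (@Label F C34 (a, z * k)) => //.
  apply: (@simI 1 0 0 z (h * z)); sim_eqs.
rewrite -subr_eq0 => /neq0_inv[y xy].
have h0 : h = 0 by nsatz_field.
subst h; case: (inv_cases c) => [c0|[z cz]].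
  have k0 : k = 0 by nsatz_field.
  by subst c k; apply: label_exists_N06_diag.
have [x0 b0 d0 k_eq] : [/\ x = 0, b = 0, d = 0 & k = c] by split; nsatz_field.
subst x b d k; exists (@Label F C33 tt) => //.
(* The shear is available because [x = 0]; it makes the [ast]-square of [e1] vanish. *)
apply: (@simI 1 (- a * z) 0 z c); sim_eqs.
Qed.

(** Off the hyperplane [a = k + d - c], which is [C38], both [c] and [d] vanish and [ast] is
    diagonal. A diagonal [ast] with equal entries lies on the hyperplane, whence the restriction on
    [C39]. *)
Lemma label_exists_N07 (t : consts) : novikov_consts t ->
  novikov_consts (consts_add (type_consts N07) t) ->
  exists2 l : label, admissible l & sim (label_consts l) (type_consts N07, t).
Proof.
case: t => a b c d f g h k; rewrite /= ?zero_oneE.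
case=> -[? ? ? ?] ? ? ? [[? ? ? ?] ? ? ?].
have [b_eq g_eq f_eq h_eq] : [/\ b = - d, g = d, f = c & h = - c].
  by split; nsatz_field.
subst b g f h; case: (eqVneq a (k + d - c)) => [a_eq|].
  subst a; exists (@Label F C38 (c, d, k)) => //.
  apply: (@simI 1 0 0 1 1); sim_eqs.
rewrite -subr_eq0 => ne; have [y ay] := neq0_inv ne.
have [c0 d0] : c = 0 /\ d = 0 by split; nsatz_field.
subst c d; exists (@Label F C39 (a, k)).
  by rewrite /admissible /= eq_sym -subr_eq0; move: ne; rewrite !zero_oneE.
apply: (@simI 1 0 0 1 1); sim_eqs.
Qed.

(** * Dictionary between structure constants and algebras *)

Definition row2 (a b : F) : rV := \row_j (if j == 0 then a else b).

Lemma row2E a b : (row2 a b 0 0 = a) * (row2 a b 0 1 = b).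
Proof. by rewrite !mxE. Qed.

Lemma row2P (x y : rV) : x 0 0 = y 0 0 -> x 0 1 = y 0 1 -> x = y.
Proof.
move=> h0 h1; apply/rowP => j; case: (unliftP 0 j) => [k ->|->] //.
by rewrite (ord1 k) (_ : lift 0 0 = 1) //; apply: val_inj.
Qed.

Lemma row2_eta (x : rV) : row2 (x 0 0) (x 0 1) = x.
Proof. by apply: row2P; rewrite row2E. Qed.

Lemma row2_delta (x : rV) : x = x 0 0 *: e1 + x 0 1 *: e2.
Proof. by apply: row2P; rewrite !mxE /= ?zero_oneE. Qed.

Definition table_of (c : consts) : table F :=
  let: Consts a b c d f g h k := c in
  (row2 a b, row2 c d, row2 f g, row2 h k).

Definition consts_of (t : table F) : consts :=
  let: (t11, t12, t21, t22) := t in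
  Consts (t11 0 0) (t11 0 1) (t12 0 0) (t12 0 1)
         (t21 0 0) (t21 0 1) (t22 0 0) (t22 0 1).

Lemma consts_ofK : cancel consts_of table_of.
Proof. by case=> [[[t11 t12] t21] t22]; rewrite /= !row2_eta. Qed.

Lemma table_mulE c x y : table_mul (table_of c) x y =
  let: Consts a b c d f g h k := c in
  row2 (x 0 0 * y 0 0 * a + x 0 0 * y 0 1 * c
        + x 0 1 * y 0 0 * f + x 0 1 * y 0 1 * h)
       (x 0 0 * y 0 0 * b + x 0 0 * y 0 1 * d
        + x 0 1 * y 0 0 * g + x 0 1 * y 0 1 * k).
Proof. by case: c => a b c d f g h k; apply: row2P; rewrite !mxE. Qed.

Lemma novikovP c : novikov (table_mul (table_of c)) <-> novikov_consts c.
Proof.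
split.
  case: c => a b c d f g h k [ls rs].
  have L z j := congr1 (fun x : rV => x 0 j) (ls e1 e2 z).
  have R x j := congr1 (fun x : rV => x 0 j) (rs x e1 e2).
  move: {L R} (L e1 0) (L e1 1) (L e2 0) (L e2 1) (R e1 0) (R e1 1) (R e2 0).
  rewrite !table_mulE /= !mxE /= ?zero_oneE.
  by move=> *; do ?split; nsatz_field.
case: c => a b c d f g h k [[? ? ? ?] ? ? ?]; split=> x y z.
  rewrite !table_mulE /= !row2E.
  move: (x 0 0) (x 0 1) (y 0 0) (y 0 1) (z 0 0) (z 0 1) => x0 x1 y0 y1 z0 z1.
  by apply: row2P; rewrite !mxE /=; nsatz_field.
rewrite !table_mulE /= !row2E.
move: (x 0 0) (x 0 1) (y 0 0) (y 0 1) (z 0 0) (z 0 1) => x0 x1 y0 y1 z0 z1.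
by apply: row2P; rewrite !mxE /=; nsatz_field.
Qed.

Definition lin2 (p q r s : F) (x : rV) : rV :=
  row2 (x 0 0 * p + x 0 1 * r) (x 0 0 * q + x 0 1 * s).

Lemma lin2_linear p q r s : linear (lin2 p q r s).
Proof. by move=> a x y; apply: row2P; rewrite !mxE /=; ring. Qed.

HB.instance Definition _ p q r s :=
  GRing.isLinear.Build F rV rV _ (lin2 p q r s) (lin2_linear p q r s).

(** The inverse is the adjugate times [u]. *)
Lemma lin2_bij p q r s u : (p * s - q * r) * u = 1 -> bijective (lin2 p q r s).
Proof.
move=> det; exists (lin2 (u * s) (- u * q) (- u * r) (u * p)) => x;
  by apply: row2P; rewrite /lin2 !row2E;
  move: (x 0 0) (x 0 1) => {x} x0 x1; nsatz_field.
Qed.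

Lemma linear_lin2 (f : {linear rV -> rV}) x :
  f x = lin2 (f e1 0 0) (f e1 0 1) (f e2 0 0) (f e2 0 1) x.
Proof.
by rewrite {1}(row2_delta x) linearD !linearZ; apply: row2P; rewrite !mxE.
Qed.

Lemma bij_lin2 (f : {linear rV -> rV}) : bijective f ->
  exists u, (f e1 0 0 * f e2 0 1 - f e1 0 1 * f e2 0 0) * u = 1.
Proof.
case=> g _ gK.
have H z j := congr1 (fun x : rV => x 0 j) (gK z).
move: {H} (H e1 0) (H e1 1) (H e2 0) (H e2 1).
rewrite !(linear_lin2 f (g _)) !mxE /= ?zero_oneE => H0 H1 H2 H3.
(* The determinant of the inverse map. *)
exists (g e1 0 0 * g e2 0 1 - g e1 0 1 * g e2 0 0).
move: (f e1 0 0) (f e1 0 1) (f e2 0 0) (f e2 0 1)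
  (g e1 0 0) (g e1 0 1) (g e2 0 0) (g e2 0 1) H0 H1 H2 H3 => *.
by nsatz_field.
Qed.

Lemma mapsP p q r s c c' : maps p q r s c c' <->
  {morph lin2 p q r s : x y /
     table_mul (table_of c) x y >-> table_mul (table_of c') x y}.
Proof.
split=> [|H].
  case: c c' => a b c d f g h k [a' b' c' d' f' g' h' k'].
  case=> -[? ?] [? ?] [? ?] [? ?] x y.
  rewrite !table_mulE /lin2 /= !row2E.
  by apply: row2P; rewrite !row2E;
  move: (x 0 0) (x 0 1) (y 0 0) (y 0 1) => {x y} x0 x1 y0 y1; nsatz_field.
have L i j k := congr1 (fun x : rV => x 0 k)
  (H (delta_mx 0 i) (delta_mx 0 j)).
move: {L H} (L 0 0 0) (L 0 0 1) (L 0 1 0) (L 0 1 1) (L 1 0 0) (L 1 0 1)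
  (L 1 1 0) (L 1 1 1).
case: c c' => a b c d f g h k [a' b' c' d' f' g' h' k'].
rewrite !table_mulE /lin2 /= !row2E !mxE /= ?zero_oneE => *.
by do ?split; nsatz_field.
Qed.

Lemma isoP c1 c2 c1' c2' :
  isomorphic (algebra_of_tables (table_of c1, table_of c2))
    (algebra_of_tables (table_of c1', table_of c2'))
  <-> sim (c1, c2) (c1', c2').
Proof.
split=> [[f [bij_f dot_f ast_f]]|[p [q [r [s [u [det dot_m ast_m]]]]]]].
  have [u det] := bij_lin2 bij_f.
  exists (f e1 0 0), (f e1 0 1), (f e2 0 0), (f e2 0 1), u; split=> //.
    by apply/mapsP => x y; rewrite -!linear_lin2; apply: dot_f.
  by apply/mapsP => x y; rewrite -!linear_lin2; apply: ast_f.
pose T c c' := algebra_of_tables (table_of c, table_of c').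
apply: (@isomorphicI F (T c1 c2) (T c1' c2') (lin2 p q r s)).
- exact: lin2_linear.
- exact: lin2_bij det.
- exact/mapsP.
- exact/mapsP.
Qed.

Lemma transport_mul (V : lmodType F) (f : {linear V -> rV})
    (m : {bilinear V -> V -> V}) : bijective f ->
  exists c, {morph f : x y / m x y >-> table_mul (table_of c) x y}.
Proof.
case=> g fK gK.
exists (consts_of (f (m (g e1) (g e1)), f (m (g e1) (g e2)),
  f (m (g e2) (g e1)), f (m (g e2) (g e2)))).
rewrite consts_ofK => x y.
have dec z : z = f z 0 0 *: g e1 + f z 0 1 *: g e2.
  by apply: (can_inj fK); rewrite linearD !linearZ !gK; apply: row2_delta.
rewrite {1}(dec x) {1}(dec y).
rewrite linearDl !linearZl_LR !linearDr !linearZr_LR.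
by rewrite !linearD /= !linearZ /= !scalerA addrA.
Qed.

Lemma ex_coordinates (A : double_algebra F) : \dim {:A} = 2%N ->
  exists f : {linear A -> rV}, bijective f.
Proof.
rewrite dimvf => dimA.
(* [v2r] indexes coordinates by the dimension, which equals 2 only propositionally; hence the
   casts. *)
pose f (x : A) : rV := \row_j v2r x 0 (cast_ord (esym dimA) j).
have lin_f : linear f.
  by move=> a x y; apply/rowP=> j; rewrite !mxE linearP !mxE.
pose f_lin := GRing.isLinear.Build _ _ _ _ f lin_f.
pose f' : {linear A -> rV} := HB.pack f f_lin.
exists f'; exists (fun y : rV => r2v (\row_j y 0 (cast_ord dimA j))) => x.
  apply: (can_inj v2rK); rewrite r2vK; apply/rowP=> j.
  by rewrite !mxE cast_ordK.
by apply/rowP=> j; rewrite !mxE r2vK mxE cast_ordKV.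
Qed.

Lemma ex_tables (A : double_algebra F) : \dim {:A} = 2%N ->
  exists c1 c2,
    isomorphic A (algebra_of_tables (table_of c1, table_of c2)).
Proof.
case/ex_coordinates=> f bij_f.
have [c1 dot_f] := transport_mul (dot A) bij_f.
have [c2 ast_f] := transport_mul (ast A) bij_f.
by exists c1, c2, f.
Qed.

Lemma compatible_novikovP (c1 c2 : consts) :
  compatible_novikov (algebra_of_tables (table_of c1, table_of c2)) <->
  [/\ novikov_consts c1, novikov_consts c2 & novikov_consts (consts_add c1 c2)].
Proof.
have addE x y : table_mul (table_of c1) x y + table_mul (table_of c2) x y
    = table_mul (table_of (consts_add c1 c2)) x y.
  rewrite !table_mulE; case: c1 c2 => a b c d f g h k [a' b' c' d' f' g' h' k'].
  by apply: row2P; rewrite !mxE /=; ring.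
split=> -[/novikovP n1 /novikovP n2 n3]; split=> //.
  by apply/novikovP; apply: novikov_ext n3.
by move/novikovP: n3; apply: novikov_ext => x y; rewrite -addE.
Qed.

(** * Normal form of one multiplication, then a label for the pair *)

Lemma common_right_eigenvector c : novikov (table_mul (table_of c)) ->
  exists2 v : rV, v != 0 &
    forall y, exists a, table_mul (table_of c) v y = a *: v.
Proof.
case=> _ rs; set m := table_mul _ in rs *.
(* [R j] is right multiplication by a basis vector, acting on rows. Right commutativity says that
   [R 0] and [R 1] commute, and an eigenvector of both is one for every right multiplication by
   linearity. *)
pose R j : 'M[F]_2 := \matrix_(i, k) m (delta_mx 0 i) (delta_mx 0 j) 0 k.
have RE v j : v *m R j = m v (delta_mx 0 j).
  have rowR i : row i (R j) = m (delta_mx 0 i) (delta_mx 0 j).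
    by apply/rowP=> k; rewrite !mxE.
  rewrite [in LHS](row2_delta v) [in RHS](row2_delta v) mulmxDl -!scalemxAl.
  by rewrite -!rowE !rowR /m linearDl !linearZl_LR.
have R_comm : R 0 *m R 1 = R 1 *m R 0.
  by apply/row_matrixP=> i; rewrite !rowE !mulmxA !RE rs.
have [v v0 /andP[]] := @common_eigenvector2 F 2 _ _ isT R_comm.
rewrite !RE => /sub_rVP[a va] /sub_rVP[b vb]; exists v => // y.
exists (y 0 0 * a + y 0 1 * b).
rewrite [in LHS](row2_delta y) /m linearDr !linearZr_LR.
by rewrite scalerDl -!scalerA -va -vb.
Qed.

Lemma ex_basis_of_vector (v : rV) : v != 0 ->
  exists p q u, (p * v 0 1 - q * v 0 0) * u = 1.
Proof.
move=> v0; case: (eqVneq (v 0 1) 0) => [v1|/neq0_inv[u v1]]; last first.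
  by exists 1, 0, u; rewrite mul0r subr0 mul1r.
have /neq0_inv[u vu] : v 0 0 != 0.
  by apply: contraNneq v0 => v00; apply/eqP/row2P; rewrite ?v1 ?v00 mxE.
by exists 0, 1, (- u); rewrite mul0r sub0r mul1r mulrNN.
Qed.

Local Notation alg c c' := (algebra_of_tables (table_of c, table_of c')).

(* t' is t in the basis (p, q), (r, s). *)
Lemma change_basis p q r s u t : (p * s - q * r) * u = 1 ->
  exists t', maps p q r s t' t /\
    (novikov (table_mul (table_of t)) -> novikov (table_mul (table_of t'))).
Proof.
move=> det; have [g fK gK] := lin2_bij det.
pose g_lin := GRing.isLinear.Build _ _ _ _ g (can2_linear fK gK).
pose h : {linear rV -> rV} := HB.pack g g_lin.
have bij_h : bijective h by exists (lin2 p q r s).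
have [t' h_mul] := transport_mul (table_mul (table_of t)) bij_h.
exists t'; split; last exact: novikov_morph bij_h h_mul.
apply/mapsP => x y; apply: (can_inj gK); rewrite fK.
by rewrite [RHS](h_mul (lin2 p q r s x)) /= !fK.
Qed.

Lemma novikov_type_of c : novikov (table_mul (table_of c)) ->
  exists n, sim (consts0, type_consts n) (consts0, c).
Proof.
move=> nov; have [v v0 eig] := common_right_eigenvector nov.
have [p [q [u det]]] := ex_basis_of_vector v0.
have [c' [c'_maps /(_ nov) nov']] := change_basis c det.
have lin_e2 : lin2 p q (v 0 0) (v 0 1) e2 = v.
  by apply: row2P; rewrite /lin2 row2E !mxE /= ?zero_oneE.
(* In the new basis [e2] is the eigenvector; this yields the two zeros in [novikov_type_exists]. *)
have e2_eig y : table_mul (table_of c') e2 y 0 0 = 0.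
  have [a va] := eig (lin2 p q (v 0 0) (v 0 1) y).
  have -> : table_mul (table_of c') e2 y = a *: e2.
    apply: (bij_inj (lin2_bij det)).
    by rewrite (proj1 (mapsP _ _ _ _ _ _) c'_maps) linearZ /= lin_e2 va.
  by rewrite !mxE /= mulr0.
have c'_sim : sim (consts0, c') (consts0, c).
  by exists p, q, (v 0 0), (v 0 1), u; split; rewrite //= ?zero_oneE.
have [n n_sim] : exists n, sim (consts0, type_consts n) (consts0, c').
  move: (e2_eig e1) (e2_eig e2) => {c'_maps c'_sim e2_eig}.
  move/novikovP: nov' => {nov}; case: c' => a b x d f l k m nov.
  rewrite !table_mulE /= !row2E !mxE /= ?zero_oneE => f0 k0.
  by subst f k; apply: novikov_type_exists.
exists n; apply/isoP; apply: isomorphic_trans (proj2 (isoP _ _ _ _) c'_sim).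
exact/isoP.
Qed.

Lemma type_label_consts n : n <> N0 ->
  label_consts (type_label n) = (consts0, type_consts n).
Proof. by case: n. Qed.

Lemma type_label_admissible n : admissible (type_label n).
Proof. by case: n. Qed.

Lemma label_exists (n : novikov_type) c : n <> N0 ->
  novikov_consts c -> novikov_consts (consts_add (type_consts n) c) ->
  exists2 l : label, admissible l & sim (label_consts l) (type_consts n, c).
Proof.
case: n => [|||||a|] // _.
- exact: label_exists_N01.
- exact: label_exists_N03.
- exact: label_exists_N04.
- exact: label_exists_N05.
- exact: label_exists_N06.
- exact: label_exists_N07.
Qed.

Lemma algebra_of_consts (l : label) :
  algebra_of l = alg (label_consts l).1 (label_consts l).2.
Proof.
rewrite /algebra_of; congr algebra_of_tables.
rewrite /label_consts /dot_type /ast_consts.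
case: l => [[] x] /=; do ?[case: x => [[x y] z] || case: x => x y].
all: by congr (_, _); congr (_, _, _, _); apply: row2P;
  rewrite ?row2E !mxE /= ?mulNr ?zero_oneE.
Qed.

Lemma exists_label (A : double_algebra F) :
  \dim {:A} = 2%N -> compatible_novikov A -> nonzero A ->
  exists2 l : label, admissible l & isomorphic A (algebra_of l).
Proof.
move=> /ex_tables[c1 [c2 iso_A]] nov_A nz_A.
have := isomorphic_novikov iso_A nov_A.
have := isomorphic_nonzero iso_A nz_A.
move: iso_A => /isomorphic_trans tr nz nov.
suff [l adm iso_l] : exists2 l : label, admissible l
    & isomorphic (alg c1 c2) (algebra_of l).
  by exists l => //; apply: tr.
have [n1 _ _] := proj1 (compatible_novikovP _ _) nov.
have [n n_sim] := novikov_type_of (proj2 (novikovP _) n1).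
have [p [q [r [s [u [det _ n_map]]]]]] := n_sim.
have [c [c_maps _]] := change_basis c2 det.
have /isomorphic_sym iso_c : isomorphic (alg (type_consts n) c) (alg c1 c2).
  by apply/isoP; exists p, q, r, s, u.
have [_ m2 m12] := proj1 (compatible_novikovP _ _)
  (isomorphic_novikov iso_c nov).
(* If [dot] vanishes, [ast] is brought to normal form instead, and its type is not [N0] because the
   algebra is nonzero. *)
case: (boolP (if n is N0 then true else false)) => [n0|n0]; last first.
  have [l adm l_sim] : exists2 l : label, admissible l
      & sim (label_consts l) (type_consts n, c).
    by apply: label_exists => // n_eq; rewrite n_eq in n0.
  exists l => //; apply: isomorphic_trans iso_c _; apply: isomorphic_sym.
  by rewrite algebra_of_consts; apply/isoP; case: (label_consts l) l_sim.
have {n0} n0 : n = N0 by case: n n0 {n_sim n_map iso_c m12}.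
subst n; have [n' n'_sim] := novikov_type_of (proj2 (novikovP _) m2).
have iso_n' : isomorphic (alg consts0 (type_consts n')) (alg c1 c2).
  apply: isomorphic_trans (isomorphic_sym iso_c).
  exact: (proj2 (isoP _ _ _ _) n'_sim).
have n'0 : n' <> N0.
  move=> n'_eq; subst n'.
  case: (isomorphic_nonzero (isomorphic_sym iso_n') nz) => -[x [y]];
    by apply; apply: row2P; rewrite /= !mxE /= !zero_oneE.
exists (type_label n'); first exact: type_label_admissible.
by rewrite algebra_of_consts type_label_consts //; apply: isomorphic_sym.
Qed.

Lemma label_isoP (l l' : label) : admissible l -> admissible l' ->
  isomorphic (algebra_of l) (algebra_of l') <-> same_class l l'.
Proof.
move=> adm adm'; rewrite !algebra_of_consts; split=> [/isoP l_l'|].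
  by apply: label_unique => //; case: (label_consts l) (label_consts l') l_l'.
have coincide_iso (l1 l2 : label) : coincide l1 l2 ->
  isomorphic (alg (label_consts l1).1 (label_consts l1).2)
    (alg (label_consts l2).1 (label_consts l2).2).
  move=> {l l' adm adm'} co; apply/isoP; case: l1 l2 / co.
  (* The witnesses are the shear by [1 / c], the sign change of [e2], and twice the exchange of [e1]
     and [e2]. *)
  - move=> b c /neq0_inv[z cz]; exists 1, z, 0, 1, 1.
    by split; rewrite /= ?zero_oneE; do ?split; nsatz_field.
  - move=> a b; exists 1, 0, 0, (-1), (-1).
    by split; rewrite /= ?zero_oneE; do ?split; nsatz_field.
  - move=> a b c; exists 0, 1, 1, 0, (-1).
    by split; rewrite /= ?zero_oneE; do ?split; nsatz_field.
  - move=> a b; exists 0, 1, 1, 0, (-1).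
    by split; rewrite /= ?zero_oneE; do ?split; nsatz_field.
case=> [-> | /coincide_iso | /coincide_iso /isomorphic_sym] //.
exact: isomorphic_refl.
Qed.

(** * Correctness of the list and its commutative members *)

Definition comm_consts (t : consts) :=
  let: Consts a b c d f g h k := t in c = f /\ d = g.

Lemma table_mul_comm (c : consts) :
  commutative (table_mul (table_of c)) <-> comm_consts c.
Proof.
case: c => a b c d f g h k; split=> [C|[-> ->] x y].
  have := C e1 e2; rewrite !table_mulE !mxE /= ?zero_oneE.
  move=> E; have E0 := congr1 (fun x : rV => x 0 0) E.
  by have := congr1 (fun x : rV => x 0 1) E; move: E0; rewrite !row2E.
by rewrite !table_mulE; congr row2; ring.
Qed.

Lemma label_comm (l : label) :
  comm_consts (label_consts l).1 /\ comm_consts (label_consts l).2 <->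
  in_comm_assoc_list l.
Proof.
rewrite /label_consts /dot_type /ast_consts /in_comm_assoc_list.
case: l => [[] x] /=; do ?[case: x => [[x y] z] || case: x => x y];
  rewrite /= ?oppr0; split=> [[[? ?] [? ?]]|].
all: try done.
all: try (by exfalso; apply: one_neq_zero; nsatz_field).
all: try (by apply/eqP; nsatz_field).
all: try (by apply/andP; split; apply/eqP; nsatz_field).
all: try (by move/eqP->).
all: try (by case/andP => /eqP-> /eqP->).
Qed.

Lemma type_nonzero (n : novikov_type) : n <> N0 ->
  exists x y, table_mul (table_of (type_consts n)) x y <> 0.
Proof.
have ne (x y : rV) j : x 0 j = y 0 j + 1 -> x <> y.
  move=> xy x_y; move: xy; rewrite x_y -[LHS]addr0.
  by move/addrI/esym/one_neq_zero.
(* The goal for [N04] is brought to the front: among the nonzero types it is the only one where [e1]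
   has square zero. *)
case: n => [|||||a|] // _; first 2 last.
- exists e2, e1; apply: (ne _ _ 0).
  by rewrite table_mulE !mxE /= !zero_oneE.
all: exists e1, e1.
all: by [ apply: (ne _ _ 0); rewrite table_mulE !mxE /= !zero_oneE
        | apply: (ne _ _ 1); rewrite table_mulE !mxE /= !zero_oneE].
Qed.

Lemma label_correct (l : label) :
  [/\ compatible_novikov (algebra_of l), nonzero (algebra_of l)
    & compatible_comm_assoc (algebra_of l) <-> in_comm_assoc_list l].
Proof.
have nov : compatible_novikov (algebra_of l).
  rewrite algebra_of_consts; apply/compatible_novikovP.
  rewrite /label_consts /dot_type /ast_consts.
  case: l => [[] x] /=; do ?[case: x => [[x y] z] || case: x => x y];
  by rewrite /= ?zero_oneE; do ?split; nsatz_field.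
split=> //; rewrite algebra_of_consts in nov *.
  have nz : dot_type l <> N0 ->
      nonzero (alg (label_consts l).1 (label_consts l).2).
    by move=> /type_nonzero[x [y xy]]; left; exists x, y.
  case En: (dot_type l) nz => [|||||a|] nz; try exact: nz.
  case: (dot_zero_label En) => n [/type_nonzero[x [y xy]] _ An].
  by right; exists x, y; rewrite /= An.
rewrite -label_comm; split=> [[[C1 _] [C2 _] _]|].
  by split; apply/table_mul_comm.
case=> /table_mul_comm C1 /table_mul_comm C2.
case: nov => n1 n2 n3; split; apply: comm_novikov_assoc => //.
by move=> x y /=; rewrite C1 C2.
Qed.

End Classification.

(** * Counting the families, and assembly of the classification *)

Lemma arity_counts :
  [/\ #|[set f | arity f == 3]| = 3, #|[set f | arity f == 2]| = 7,
      #|[set f | arity f == 1]| = 11 & #|[set f | arity f == 0]| = 7]%N.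
Proof. by split; rewrite cardsE cardE /enum_mem unlock. Qed.

Theorem theoremA4 (R : realType) :
  [/\
      exists A : nat -> double_algebra R[i],
        (forall n, \dim {:A n} = 2%N /\ compatible_novikov (A n)) /\
        (forall m n, isomorphic (A m) (A n) -> m = n),
      [/\ #|[set f | arity f == 3]| = 3, #|[set f | arity f == 2]| = 7,
          #|[set f | arity f == 1]| = 11 & #|[set f | arity f == 0]| = 7]%N,
      forall l : label R[i], admissible l ->
        [/\ compatible_novikov (algebra_of l), nonzero (algebra_of l)
          & compatible_comm_assoc (algebra_of l) <-> in_comm_assoc_list l],
      forall A : double_algebra R[i],
        \dim {:A} = 2%N -> compatible_novikov A -> nonzero A ->
        exists l, [/\ admissible l, isomorphic A (algebra_of l)
          & forall l', admissible l' ->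
              isomorphic A (algebra_of l') -> same_class l l']
    & 
      forall l1 l2 : label R[i], admissible l1 -> admissible l2 ->
        isomorphic (algebra_of l1) (algebra_of l2) <-> same_class l1 l2].
Proof.
split.
(* [C15] occurs in no coincidence, and characteristic zero makes its integer parameters distinct. *)
- exists (fun n => algebra_of (@Label R[i] C15 n%:R)); split=> [n|m n].
    split; first by rewrite dimvf /= /dim /= mul1n.
    by case: (label_correct (@Label R[i] C15 n%:R)).
  case/label_isoP => //.
  + move/(congr1 (@ast_consts _)); case=> /eqP.
    by rewrite eqr_nat => /eqP.
  + by move=> co; inversion co.
  + by move=> co; inversion co.
- exact: arity_counts.
- by move=> l _; apply: label_correct.
- move=> A dimA nov nz; have [l adm iso_l] := exists_label dimA nov nz.
  exists l; split=> // l' adm' iso_l'; apply/label_isoP => //.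
  exact: isomorphic_trans (isomorphic_sym iso_l) iso_l'.
- exact: label_isoP.
Qed.
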